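(* Let $G$ be a strongly connected $k$-out graph. If $|\operatorname{Aut}(G)|$ is divisible by a prime $p>k$, then $G$ is not totally synchronizing.
   Context: A graph is a finite directed multigraph $G=(V,E,s,t)$ with source and target maps $s,t:E\to V$ (loops and parallel edges allowed). It is $k$-out if every vertex has exactly $k$ outgoing edges. An automorphism of $G$ is a pair $\varphi=(\varphi_v,\varphi_e)$ of bijections $V\to V$, $E\to E$ with $s\varphi_e=\varphi_v s$ and $t\varphi_e=\varphi_v t$; $\operatorname{Aut}(G)$ is the group of automorphisms (automorphisms fixing all vertices but permuting parallel edges are counted as nontrivial elements). A coloring of $G$ is a map $\chi:E\to[k]=\{1,\dots,k\}$ whose restriction to the set of outgoing edges of each vertex is a bijection onto $[k]$. It defines the deterministic complete automaton $\chi(G)=(V,[k],\delta_\chi)$, where $\delta_\chi(v,a)=t(e)$ for the unique edge $e$ with $s(e)=v$, $\chi(e)=a$. The automaton is synchronizing if there is a word $w\in[k]^*$ with $|V\cdot w|=1$. $G$ is totally synchronizing if $\chi(G)$ is synchronizing for every coloring $\chi$ of $G$. *)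

(* Defs.v *)
From HB Require Import structures.
From mathcomp Require Import all_boot all_fingroup.

Set Implicit Arguments.
Unset Strict Implicit.
Unset Printing Implicit Defensive.

Record digraph := Digraph {
  vertex : finType;
  edge : finType;
  source : edge -> vertex;
  target : edge -> vertex
}.

Section Digraph.

Variable G : digraph.

Definition out_edges (v : vertex G) : {set edge G} := [set e | source e == v].

Definition k_out (k : nat) : Prop := forall v : vertex G, #|out_edges v| = k.

Definition adjacent : rel (vertex G) :=
  [rel u v | [exists e : edge G, (source e == u) && (target e == v)]].

Definition strongly_connected : Prop :=
  forall u v : vertex G, connect adjacent u v.

(* Elements are pairs (vertex permutation, edge permutation), so permuting
   parallel edges while fixing every vertex is a nontrivial automorphism. *)
Definition graph_aut : {set {perm (vertex G)} * {perm (edge G)}} :=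
  [set f : {perm (vertex G)} * {perm (edge G)} | [forall e : edge G,
     (source (f.2 e) == f.1 (source e)) && (target (f.2 e) == f.1 (target e))]].

Lemma graph_aut_group_set : group_set graph_aut.
Proof.
apply/group_setP; split=> [|f g].
  by rewrite inE; apply/forallP=> e /=; rewrite !perm1 !eqxx.
rewrite !inE => /forallP autf /forallP autg; apply/forallP=> e /=.
have /andP[/eqP fs /eqP ft] := autf e.
have /andP[/eqP gs /eqP gt] := autg (f.2 e).
by rewrite !permM gs gt fs ft !eqxx.
Qed.

Canonical graph_aut_group := Group graph_aut_group_set.

End Digraph.

Record automaton (k : nat) := Automaton {
  state : finType;
  trans : state -> 'I_k -> state
}.

Definition run k (A : automaton k) (q : state A) (w : seq 'I_k) : state A :=
  foldl (@trans k A) q w.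

Definition synchronizing k (A : automaton k) : Prop :=
  exists w : seq 'I_k, #|[set run q w | q : state A]| = 1.

Section Coloring.

Variables (G : digraph) (k : nat).

(* The color set {1, ..., k} is represented by 'I_k = {0, ..., k - 1}. *)
Definition coloring (chi : edge G -> 'I_k) : Prop :=
  forall v : vertex G,
    {in out_edges v &, injective chi} /\ chi @: out_edges v = [set: 'I_k].

(* The default value v is never taken when chi is a coloring: see
   color_transP. *)
Definition color_trans (chi : edge G -> 'I_k) (v : vertex G) (a : 'I_k) :
    vertex G :=
  if [pick e | (source e == v) && (chi e == a)] is Some e then target e else v.

Lemma color_transP (chi : edge G -> 'I_k) (v : vertex G) (a : 'I_k) :
  coloring chi ->
  exists! e : edge G,
    [/\ source e = v, chi e = a & color_trans chi v a = target e].
Proof.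
move=> /(_ v)[injc imc].
have : a \in chi @: out_edges v by rewrite imc inE.
case/imsetP=> e0 e0v def_a; rewrite /color_trans.
case: pickP => [e /andP[/eqP se /eqP ce] | /(_ e0)]; last first.
  by rewrite /= -def_a eqxx andbT; move: e0v; rewrite inE => ->.
exists e; split=> // e' [se' ce' _].
by apply: injc; rewrite ?inE ?se ?se' ?eqxx // ce ce'.
Qed.

Definition color_automaton (chi : edge G -> 'I_k) : automaton k :=
  Automaton (color_trans chi).

Definition totally_synchronizing : Prop :=
  forall chi : edge G -> 'I_k, coloring chi ->
    synchronizing (color_automaton chi).

End Coloring.

(* Main.v *)
Require Import Defs.
From HB Require Import structures.
From mathcomp Require Import all_boot all_fingroup.
From mathcomp Require Import cyclic pgroup.

(** By Cauchy's theorem there is an automorphism [f] of order [p]. Its orbits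
    have size [1] or [p]; if it fixed a vertex [v], it would fix each of the
    [k < p] edges leaving [v], hence their targets, and by strong connectivity
    everything. So the group generated by [f] acts freely on the vertices, and
    a numbering of the edges leaving one representative of each vertex orbit
    can be transported along [f] to an [f]-invariant coloring. Then [f] commutes
    with the action of words, so a synchronizing word would yield a vertex
    fixed by [f]. *)

Set Implicit Arguments.
Unset Strict Implicit.
Unset Printing Implicit Defensive.

Local Open Scope group_scope.

Lemma fst_expg (gT hT : finGroupType) (x : gT * hT) n : (x ^+ n).1 = x.1 ^+ n.
Proof. by elim: n => // n IHn; rewrite !expgS -IHn. Qed.

Lemma snd_expg (gT hT : finGroupType) (x : gT * hT) n : (x ^+ n).2 = x.2 ^+ n.
Proof. by elim: n => // n IHn; rewrite !expgS -IHn. Qed.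

(** The cycle of [x] stays inside [A], and its length divides the order of [s], hence [p]. Length
    [p] exceeds [#|A|], so the length is 1. *)
Lemma perm_fix_small_set (T : finType) (s : {perm T}) (p : nat) (A : {set T}) :
    prime p -> s ^+ p = 1 -> {in A, forall x, s x \in A} -> #|A| < p ->
  {in A, forall x, s x = x}.
Proof.
move=> p_pr sp1 sA ltAp x Ax.
have sub_orb : porbit s x \subset A.
  apply/subsetP=> _ /porbitP[i ->].
  by rewrite permX; elim: i => //= i IHi; apply: sA.
have : #|porbit s x| %| p.
  rewrite porbitE; apply: dvdn_trans (dvdn_orbit _ _ _) _.
  by rewrite -orderE order_dvdn sp1.
have /primeP[_ p_div] := p_pr; case/p_div/pred2P => [orb1 | orbp].
  by have := iter_porbit s x; rewrite orb1.
by have := subset_leq_card sub_orb; rewrite orbp leqNgt ltAp.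
Qed.

Section GraphAutomorphisms.

Variables (G : digraph) (k p : nat).
Implicit Types (v : vertex G) (e : edge G).
Implicit Types (f : {perm (vertex G)} * {perm (edge G)}).

Lemma graph_aut_source f e :
  f \in graph_aut G -> source (f.2 e) = f.1 (source e).
Proof. by rewrite inE => /forallP/(_ e)/andP[/eqP]. Qed.

Lemma graph_aut_target f e :
  f \in graph_aut G -> target (f.2 e) = f.1 (target e).
Proof. by rewrite inE => /forallP/(_ e)/andP[_ /eqP]. Qed.

Hypotheses (outG : k_out G k) (conG : strongly_connected G).
Hypotheses (p_pr : prime p) (ltkp : k < p).

Lemma graph_aut_fix_vertex f v :
  f \in graph_aut G -> f ^+ p = 1 -> f.1 v = v -> f = 1.
Proof.
move=> autf fp1 fv.
have fix_out u : f.1 u = u -> {in out_edges u, forall e, f.2 e = e}.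
  move=> fu; apply: (perm_fix_small_set p_pr); last by rewrite outG.
    by rewrite -snd_expg fp1.
  by move=> e; rewrite !inE graph_aut_source // => /eqP->; rewrite fu.
have fix_all u : f.1 u = u.
  have /connectP[q] := conG v u.
  elim: q v fv => [|w q IHq] v' fv' /=; first by move=> _ ->.
  case/andP=> /existsP[e /andP[/eqP se /eqP te]] pq lq; apply: IHq pq lq.
  by rewrite -te -graph_aut_target // (fix_out v') // inE se.
rewrite [f]surjective_pairing; congr pair; apply/permP=> x; rewrite perm1 //.
by apply: (fix_out (source x)) => //; rewrite inE.
Qed.

(** The quotient of the two powers fixes [v] and has trivial [p]-th power, so it is 1. The powers
    then agree on edges too, which the invariance of the coloring requires. *)
Lemma graph_aut_expg_free f v m n :
    f \in graph_aut G -> f ^+ p = 1 -> (f ^+ m).1 v = (f ^+ n).1 v ->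
  f ^+ m = f ^+ n.
Proof.
move=> autf fp1 eq_mn; apply/eqP; rewrite eq_mulgV1; apply/eqP.
apply: (@graph_aut_fix_vertex _ v); first by rewrite groupM ?groupV ?groupX.
  rewrite expgMn; last by apply/commuteV/commuteX2/commute_refl.
  by rewrite expgVn -!expgM ![(_ * p)%N]mulnC !expgM fp1 !expg1n invg1 mulg1.
by rewrite /= permM eq_mn permK.
Qed.

Lemma ltn_index_out e :
  index e (enum (out_edges (source e))) < k.
Proof. by rewrite -(outG (source e)) cardE index_mem mem_enum inE. Qed.

Definition out_rank e : 'I_k := Ordinal (ltn_index_out e).

Lemma out_rank_inj v : {in out_edges v &, injective out_rank}.
Proof.
move=> e e'; rewrite !inE => /eqP se /eqP se' [].
by rewrite se se' => /index_inj; apply; rewrite ?mem_enum ?inE ?se ?se'.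
Qed.

(** Each vertex has [k] outgoing edges and there are [k] colors, so surjectivity follows by
    counting. *)
Lemma inj_coloring (chi : edge G -> 'I_k) :
  (forall v, {in out_edges v &, injective chi}) -> coloring chi.
Proof.
move=> inj_chi v; split=> //; apply/eqP.
by rewrite eqEcard subsetT cardsT card_ord card_in_imset ?outG /=.
Qed.

Section InvariantColoring.

Variable f : {perm (vertex G)} * {perm (edge G)}.
Hypotheses (autf : f \in graph_aut G) (fp1 : f ^+ p = 1).

Definition root_dist v := findex f.1 v (froot f.1 v).

Lemma root_distE v : (f ^+ root_dist v).1 v = froot f.1 v.
Proof. by rewrite fst_expg permX iter_findex // connect_root. Qed.

Definition invariant_coloring e := out_rank ((f ^+ root_dist (source e)).2 e).

Lemma invariant_coloringP : coloring invariant_coloring.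
Proof.
apply: inj_coloring => v e e'; rewrite !inE /invariant_coloring.
move=> /eqP se /eqP se'; rewrite se se' => eq_rank.
apply: (@perm_inj _ (f ^+ root_dist v).2).
(* Both transported edges leave the orbit root, where ranks are distinct. *)
by apply: (@out_rank_inj (froot f.1 v)) eq_rank;
  rewrite inE graph_aut_source ?groupX // ?se ?se' root_distE.
Qed.

Lemma invariant_coloring_aut e :
  invariant_coloring (f.2 e) = invariant_coloring e.
Proof.
rewrite /invariant_coloring graph_aut_source //; set v := source e.
(* The exponents themselves may differ: if [v] is the root, they are the orbit size and 0. Both
   powers send [v] to the root, so freeness makes them equal. *)
have eq_exp : f ^+ (root_dist (f.1 v)).+1 = f ^+ root_dist v.
  apply: (@graph_aut_expg_free _ v) => //.
  rewrite expgS permM !root_distE; apply/esym/eqP.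
  by rewrite (root_connect (fconnect_sym (@perm_inj _ f.1))) fconnect1.
by rewrite -eq_exp expgS /= permM.
Qed.

End InvariantColoring.

Lemma run_graph_aut (chi : edge G -> 'I_k) f v w :
    coloring chi -> f \in graph_aut G -> (forall e, chi (f.2 e) = chi e) ->
  run (A := color_automaton chi) (f.1 v) w
    = f.1 (run (A := color_automaton chi) v w).
Proof.
move=> chiP autf chif; rewrite /run; elim: w v => //= a w IHw v.
rewrite -IHw; congr (foldl _ _ w).
have [e [[se ce ->] _]] := color_transP v a chiP.
have [e' [[se' ce' ->] _]] := color_transP (f.1 v) a chiP.
rewrite -graph_aut_target //; congr target.
have [inj_chi _] := chiP (f.1 v).
(* Both [f.2 e] and [e'] leave [f.1 v] with color [a]. *)
by apply: inj_chi; rewrite ?inE ?se' ?graph_aut_source ?se // chif ce.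
Qed.

End GraphAutomorphisms.

Theorem corollary3p11 (G : digraph) (k p : nat) :
  k_out G k ->
  strongly_connected G ->
  prime p ->
  k < p ->
  p %| #|graph_aut G| ->
  ~ totally_synchronizing G k.
Proof.
move=> outG conG p_pr ltkp p_dvd syncG.
have [f autf ordf] := Cauchy p_pr p_dvd.
have fp1 : f ^+ p = 1 by rewrite -ordf expg_order.
have chiP := invariant_coloringP outG autf.
have [w /eqP/cards1P[y im_w]] := syncG _ chiP.
have run_y q : run (A := color_automaton (invariant_coloring outG f)) q w = y.
  by apply/set1P; rewrite -im_w imset_f.
have := set11 y; rewrite -im_w => /imsetP[v _ _].
have fy : f.1 y = y.
  (* Reading [w] from [v] and from [f.1 v] both ends in [y], so commutation forces [f] to fix
     [y]. *)
  rewrite -{1}(run_y v) -run_graph_aut ?run_y //.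
  exact: (invariant_coloring_aut outG conG p_pr ltkp autf fp1).
have f1 := graph_aut_fix_vertex outG conG p_pr ltkp autf fp1 fy.
by move: p_pr; rewrite -ordf f1 order1.
Qed.
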